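(* Let $k$ be a fixed positive integer and let $1\le k-1\le b\le n$ be integers. a) If $b\ge \frac{n+k-1}{2}$, then $$B(G_{n,k,b})=\left\lceil\frac{(n+1)\binom{b}{k-1}-(k-1)\binom{b+1}{k}+\binom{2b-n+1}{k}-2}{2}\right\rceil .$$ b) Let $b=b(n)$ depend on $n$ (with $k$ fixed and $k-1\le b(n)\le n$). If $b=o\big(n^{\frac{1}{k+1}}\big)$ as $n\to\infty$, then for all sufficiently large $n$ $$B(G_{n,k,b})=k\binom{b}{k}.$$ If $b=o(n)$ as $n\to\infty$, then $$B(G_{n,k,b})\sim k\binom{b}{k}\quad\text{as } n\to\infty .$$
   Context: $G_{n,k,b}$ is the graph whose vertices are the $k$-element subsets $X$ of $\{0,1,\dots,n\}$ with $\max(X)-\min(X)\le b$; two distinct vertices $X,Y$ are joined by an edge iff $\max(X\cup Y)-\min(X\cup Y)\le b$. For a finite graph $G=(V,E)$, a proper numbering is a bijection $f:V\to\{1,\dots,|V|\}$; its bandwidth is $B_f(G)=\max\{|f(u)-f(v)|:\{u,v\}\in E\}$ (the maximum over an empty edge set is $0$), and the bandwidth of $G$ is $B(G)=\min_f B_f(G)$ over all proper numberings $f$. $g\sim h$ as $n\to\infty$ means $g=(1+o(1))h$. *)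

(* Defs.v *)
From HB Require Import structures.
From mathcomp Require Import all_boot all_order all_algebra.
From mathcomp Require Import all_classical all_reals all_analysis.

Set Implicit Arguments.
Unset Strict Implicit.
Unset Printing Implicit Defensive.

Import Order.TTheory GRing.Theory Num.Theory.
Import numFieldNormedType.Exports.

Local Open Scope nat_scope.

(* A finite graph is given by its vertex type V and its adjacency relation e.
   Numberings take their values in 'I_#|V| = {0, ..., #|V|-1} rather than
   {1, ..., #|V|}: only differences of labels matter. *)
Definition proper_numbering (V : finType) (f : {ffun V -> 'I_#|V|}) : Prop :=
  bijective f.

Definition numbering_bandwidth (V : finType) (e : rel V)
    (f : {ffun V -> 'I_#|V|}) : nat :=
  \max_(u : V) \max_(v : V | e u v) absz (Posz (f u) - Posz (f v))%R.

Definition enum_numbering (V : finType) : {ffun V -> 'I_#|V|} :=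
  [ffun v => enum_rank v].

Lemma enum_numbering_proper (V : finType) : proper_numbering (enum_numbering V).
Proof.
exists enum_val => x; rewrite /enum_numbering ffunE.
  exact: enum_rankK.
exact: enum_valK.
Qed.

(* enum_numbering only witnesses that the set of proper numberings is
   nonempty; the value does not depend on it, by bandwidth_min below. *)
Definition bandwidth (V : finType) (e : rel V) : nat :=
  numbering_bandwidth e
    [arg min_(f < enum_numbering V | `[< proper_numbering f >])
       numbering_bandwidth e f].

Lemma bandwidth_min (V : finType) (e : rel V) :
  (exists2 f, proper_numbering f & numbering_bandwidth e f = bandwidth e) /\
  (forall f, proper_numbering f -> bandwidth e <= numbering_bandwidth e f).
Proof.
rewrite /bandwidth; case: arg_minnP => [|f /asboolP fP fmin].
  by apply/asboolP; exact: enum_numbering_proper.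
by split=> [|g gP]; [exists f | apply/fmin/asboolP].
Qed.

(* For X empty, set_min X = n and set_max X = 0; these values are irrelevant
   below, since only k-element sets with 0 < k occur. *)
Definition set_max (n : nat) (X : {set 'I_n.+1}) : nat :=
  \max_(x in X) (x : nat).

Definition set_min (n : nat) (X : {set 'I_n.+1}) : nat :=
  \big[minn/n]_(x in X) (x : nat).

Definition Gvertex (n k b : nat) : finType :=
  {X : {set 'I_n.+1} | (#|X| == k) && (set_max X - set_min X <= b)}.

Definition Gadj (n k b : nat) : rel (Gvertex n k b) := fun X Y =>
  (X != Y) && (set_max (val X :|: val Y) - set_min (val X :|: val Y) <= b).

Definition GB (n k b : nat) : nat := bandwidth (@Gadj n k b).

(* Main.v *)
Require Import Defs.
From HB Require Import structures.
From mathcomp Require Import all_boot all_order all_algebra.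
From mathcomp Require Import all_classical all_reals all_analysis.
From mathcomp Require Import zify lra.

Set Implicit Arguments.
Unset Strict Implicit.
Unset Printing Implicit Defensive.

Import Order.TTheory GRing.Theory Num.Theory.
Import numFieldNormedType.Exports.
(** Write i and j for the least and the greatest element of a vertex X.
    Two distinct vertices (i, j) and (i', j') are adjacent iff j <= i' + b and
    j' <= i + b [GadjE], so only the extremities of the sets matter.  With N
    the number of vertices, c = 'C(b, k - 1) and s = b - k + 1, there are c
    vertices with least element i as long as i + b <= n, and
    k 'C(b, k) = s c.

    Large b.  When 2b - n + 1 >= k, the D = 'C(2b - n + 1, k) subsets of
    [n - b, b] are adjacent to everything.  Such universal vertices force
    twice the bandwidth to be at least N + D - 2: their labels spread over at
    least D values, and each of them is close to both the first and the last
    label [bandwidth_ge_universal].  Conversely, put the universal vertices in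
    the middle, a half L of the others (those with i + j < n, and half of the
    ties i + j = n) before them, sorted by least element, and the other half R
    after them, sorted by greatest element.  An edge between X in L and Y in R
    is not too long provided that R has no more sets with greatest element at
    most b + min X than L has sets with least element below min X
    [bandwidth_le_split]; the reflection x -> b + min X - x injects the former
    into the latter [GB_dense_le].

    Small b.  The lexicographic order by (i, j) gives the upper bound s c for
    every n [GB_le]: an edge joins vertices whose least elements differ by at
    most s, and if they differ by exactly s then the right end is an
    interval, which comes first among the sets with its least element.  For
    the lower bound, hopping over the intervals {i + s, .., i + b} connects
    any two vertices in at most n / s + 1 steps, so that N - 1 is at most
    n / s + 1 times the bandwidth [GB_diameter].  Together,
        (k 'C(b, k) - GB n k b) n <= 2 b k 'C(b, k)        [GB_defect].
    If b = o(n), this makes the relative defect o(1); if b ^ (k + 1) = o(n),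
    the right-hand side is at most 2 b ^ (k + 1) < n, and the integer defect
    is 0. *)

Local Open Scope nat_scope.

(** * Bandwidth of finite graphs *)

Lemma card_ord_itv (n a c : nat) : c <= n ->
  #|[set x : 'I_n | a <= x < c]| = c - a.
Proof.
move=> cn; rewrite -sum1_card.
transitivity (\sum_(a <= i < c) 1); last by rewrite sum_nat_const_nat muln1.
rewrite (big_nat_widen _ _ _ _ _ cn) big_geq_mkord.
by apply: eq_bigl => i; rewrite inE andbC.
Qed.

Lemma numbering_adj_le (V : finType) (e : rel V) (f : {ffun V -> 'I_#|V|})
    (u v : V) :
  e u v || e v u -> f v <= f u + numbering_bandwidth e f.
Proof.
have aux x y : e x y ->
    absz (Posz (f x) - Posz (f y))%R <= numbering_bandwidth e f.
  move=> exy; rewrite /numbering_bandwidth.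
  apply: leq_trans (leq_bigmax x); exact: (@leq_bigmax_cond _ (e x) _ y exy).
by case/orP => /aux; lia.
Qed.

Lemma exists_monotone_numbering (V : finType) (kappa : V -> nat) :
  exists2 f : {ffun V -> 'I_#|V|}, proper_numbering f &
    forall x y, f x <= f y -> kappa x <= kappa y.
Proof.
pose s := sort (relpre kappa leq) (enum V).
have ms x : x \in s by rewrite mem_sort mem_enum.
have szs : size s = #|V| by rewrite size_sort -cardE.
have lts x : index x s < #|V| by rewrite -szs index_mem.
exists [ffun x => Ordinal (lts x)].
  apply: inj_card_bij; last by rewrite card_ord.
  move=> x y; rewrite !ffunE => /(congr1 val) /= exy.
  by rewrite -(nth_index x (ms x)) exy nth_index.
move=> x y; rewrite !ffunE /= => le_xy.
have ss : sorted (relpre kappa leq) s.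
  by apply: sort_sorted => a b; apply: leq_total.
have := @sorted_leq_nth _ _ (fun a b c => @leq_trans (kappa a) (kappa b) (kappa c))
  (fun a => leqnn (kappa a)) x s ss (index x s) (index y s).
by rewrite !inE !index_mem => /(_ (ms x) (ms y) le_xy); rewrite !nth_index.
Qed.

Lemma card_label_itv (V : finType) (f : {ffun V -> 'I_#|V|}) (x y : V) :
  proper_numbering f -> f x <= f y ->
  #|[set z | f x <= f z <= f y]| = (f y - f x).+1.
Proof.
move=> fb le_xy; have fi := bij_inj fb.
rewrite -(card_imset _ fi).
have -> : [set f z | z in [set z | f x <= f z <= f y]]
   = [set i : 'I_#|V| | f x <= i < (f y).+1].
  apply/setP => i; rewrite inE ltnS; apply/imsetP/idP => [[z]|].
    by rewrite inE => h ->.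
  by case: fb => g fg gf h; exists (g i); rewrite ?inE gf.
by rewrite card_ord_itv // subSn.
Qed.

(** A vertex numbering sorted by [kappa] gives two vertices x, y labels that
    differ by less than the number of vertices with keys between theirs,
    whatever way the ties are broken. *)
Lemma bandwidth_le_key (V : finType) (e : rel V) (kappa : V -> nat) (M : nat) :
  (forall x y, e x y || e y x -> kappa x <= kappa y ->
     #|[set z | kappa x <= kappa z <= kappa y]| <= M.+1) ->
  bandwidth e <= M.
Proof.
move=> H; have [f fP fk] := exists_monotone_numbering kappa.
apply: leq_trans ((bandwidth_min e).2 f fP) _.
have aux x y : e x y || e y x -> f x <= f y -> f y - f x <= M.
  move=> exy le_xy; rewrite -ltnS -(card_label_itv fP le_xy).
  apply: leq_trans (H x y exy (fk _ _ le_xy)); apply/subset_leq_card/fintype.subsetP => z.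
  by rewrite !inE => /andP[/fk -> /fk ->].
apply/bigmax_leqP => u _; apply/bigmax_leqP => v euv.
case/orP: (leq_total (f u) (f v)) => h.
  by have := aux u v; rewrite euv => /(_ isT h); lia.
by have := aux v u; rewrite euv orbT => /(_ isT h); lia.
Qed.

(** The numbering lists L by increasing l, then U, then R by increasing r.  The
    vertices between an x in L and a y in R number at most those of U and L,
    because what is gained in R past U is lost in L before x. *)
Lemma bandwidth_le_split (V : finType) (e : rel V) (L U R : {set V})
    (l r : V -> nat) (M : nat) :
  (forall x, [|| x \in U, x \in L | x \in R]) ->
  #|R| <= #|L| -> #|U| + #|L| <= M.+1 ->
  (forall x y, x \in L -> y \in R -> e x y || e y x ->
     #|[set z in R | r z <= r y]| <= #|[set z in L | l z < l x]|) ->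
  bandwidth e <= M.
Proof.
move=> ULR leRL leM balance; pose c := (\max_x l x).+1.
have lc x : l x < c by rewrite ltnS leq_bigmax.
(* c exceeds all values of l, so that U comes after L. *)
pose key x := if x \in U then c else if x \in L then l x else c.+1 + r x.
apply: (bandwidth_le_key (kappa := key)) => x y adj_xy _.
apply: leq_trans leM; set K := [set z | _].
have KP z : z \in K -> key x <= key z <= key y by rewrite inE.
(* If y is not in R proper, the interval of keys stays inside U and L. *)
have UL_le : y \in U :|: L -> #|K| <= #|U| + #|L|.
  move=> yUL; apply: leq_trans (leq_card_setU U L).
  apply/subset_leq_card/fintype.subsetP => z /KP/andP[_].
  move: yUL; rewrite !inE /key.
  by have := lc y; case: (y \in U); case: (y \in L) => //;
     case: (z \in U); case: (z \in L) => //; lia.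
have [yU|nyU] := boolP (y \in U); first by apply: UL_le; rewrite inE yU.
have [yL|nyL] := boolP (y \in L); first by apply: UL_le; rewrite inE yL orbT.
have yR : y \in R by have := ULR y; rewrite (negPf nyU) (negPf nyL).
(* If x is not in L proper, the interval of keys stays inside U and R. *)
have [/andP[nxU xL]|x_mid] := boolP ((x \notin U) && (x \in L)); last first.
  apply: (@leq_trans #|U :|: R|); last first.
    by rewrite (leq_trans (leq_card_setU _ _)) // leq_add2l.
  apply/subset_leq_card/fintype.subsetP => z /KP/andP[+ _].
  move: (ULR z) x_mid; rewrite inE /key.
  by have := lc z; case: (z \in U); case: (z \in L); case: (z \in R) => //;
     case: (x \in U); case: (x \in L) => //; lia.
pose Llow := [set z in L | l z < l x]; pose Rlow := [set z in R | r z <= r y].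
have sK : K \subset U :|: ((L :\: Llow) :|: Rlow).
  apply/fintype.subsetP => z /KP.
  move: (ULR z); rewrite !inE /key (negPf nxU) (negPf nyU) (negPf nyL) xL.
  by case: (z \in U); case: (z \in L); case: (z \in R) => //=; lia.
apply: leq_trans (subset_leq_card sK) _.
rewrite (leq_trans (leq_card_setU _ _)) // leq_add2l.
rewrite (leq_trans (leq_card_setU _ _)) // cardsD.
have -> : L :&: Llow = Llow.
  by apply/finset.setIidPr/fintype.subsetP => z; rewrite inE => /andP[].
have : #|Llow| <= #|L|.
  by apply/subset_leq_card/fintype.subsetP => z; rewrite inE => /andP[].
have := balance x y xL yR adj_xy; rewrite -/Llow -/Rlow.
by move: #|Llow| #|Rlow| #|L| => p q s; lia.
Qed.

(** Let p and q be the universal vertices of least and greatest label.  Then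
    f q - f p >= #|U| - 1, while f q is at most the bandwidth, because of
    the edge to label 0, and so is #|V| - 1 - f p, because of the edge to the
    last label; the three add up to the claim. *)
Lemma bandwidth_ge_universal (V : finType) (e : rel V) (U : {set V}) :
  (forall u v, u \in U -> v != u -> e u v || e v u) -> 0 < #|U| ->
  #|V| + #|U| - 2 <= (bandwidth e).*2.
Proof.
move=> HU U0; have [f fP <-] := (bandwidth_min e).1.
set B := numbering_bandwidth e f.
have [x0 x0U] := card_gt0P U0.
pose p := [arg min_(u < x0 in U) (f u : nat)].
pose q := [arg max_(u > x0 in U) (f u : nat)].
have [pU pmin] : p \in U /\ forall u, u \in U -> f p <= f u.
  by rewrite /p; case: arg_minnP => [|u uU h]; [exact: x0U | split].
have [qU qmax] : q \in U /\ forall u, u \in U -> f u <= f q.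
  by rewrite /q; case: arg_maxnP => [|u uU h]; [exact: x0U | split].
have cU : #|U| <= (f q - f p).+1.
  rewrite -(card_label_itv fP (pmin _ qU)); apply/subset_leq_card/fintype.subsetP => u uU.
  by rewrite inE pmin ?qmax.
have near u v : u \in U -> f v <= f u + B /\ f u <= f v + B.
  move=> uU; have [->|nvu] := eqVneq v u; first by rewrite leq_addr.
  by split; apply: numbering_adj_le; [exact: HU | rewrite orbC; exact: HU].
have V0 : 0 < #|V| by apply: leq_trans U0 (max_card _).
have Vlt : #|V|.-1 < #|V| by rewrite prednK.
case: (fP) => g fg gf.
have [_] := near q (g (Ordinal V0)) qU.
have [+ _] := near p (g (Ordinal Vlt)) pU.
rewrite !gf /=; have := pmin _ qU; move: cU V0.
by move: #|V| #|U| (f p : nat) (f q : nat) => N D i j; lia.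
Qed.

(* vertices *)
(** * Extremities of a vertex *)

Lemma set_min_leq (n : nat) (X : {set 'I_n.+1}) (x : 'I_n.+1) :
  x \in X -> set_min X <= x.
Proof.
rewrite /set_min => xX; have := mem_index_enum x.
elim: (index_enum _) => // y s IHs; rewrite inE big_cons => /orP[/eqP <-|xs].
  by rewrite xX geq_minl.
by case: ifP => _; [apply: leq_trans (geq_minr _ _) _|]; exact: IHs.
Qed.

Lemma set_minP (n : nat) (X : {set 'I_n.+1}) (a : nat) : a <= n ->
  reflect (forall x, x \in X -> a <= x) (a <= set_min X).
Proof.
move=> an; apply: (iffP idP) => [h x xX|h].
  exact: leq_trans h (set_min_leq xX).
rewrite /set_min; elim/big_ind: _ => // y z; by rewrite leq_min => -> ->.
Qed.

Lemma set_max_geq (n : nat) (X : {set 'I_n.+1}) (x : 'I_n.+1) :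
  x \in X -> x <= set_max X.
Proof. by move=> xX; rewrite /set_max (bigD1 x xX) leq_maxl. Qed.

Lemma set_min_eq (n : nat) (X : {set 'I_n.+1}) (x : 'I_n.+1) :
  x \in X -> (forall y, y \in X -> x <= y) -> set_min X = x.
Proof.
move=> xX h; apply/eqP; rewrite eqn_leq set_min_leq //=.
by apply/set_minP => //; rewrite -ltnS ltn_ord.
Qed.

Lemma set_max_eq (n : nat) (X : {set 'I_n.+1}) (x : 'I_n.+1) :
  x \in X -> (forall y, y \in X -> y <= x) -> set_max X = x.
Proof.
by move=> xX h; apply/eqP; rewrite eqn_leq set_max_geq // andbT; apply/bigmax_leqP.
Qed.

Lemma set_min_in (n : nat) (X : {set 'I_n.+1}) : 0 < #|X| ->
  exists2 x, x \in X & set_min X = x.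
Proof.
case/card_gt0P => x0 x0X.
case: (@arg_minnP _ x0 [in X] (fun x => x : nat) x0X) => x xX h.
by exists x => //; apply: set_min_eq.
Qed.

Lemma set_max_in (n : nat) (X : {set 'I_n.+1}) : 0 < #|X| ->
  exists2 x, x \in X & set_max X = x.
Proof.
case/card_gt0P => x0 x0X.
case: (@arg_maxnP _ x0 [in X] (fun x => x : nat) x0X) => x xX h.
by exists x => //; apply: set_max_eq.
Qed.

Definition vmin (n k b : nat) (X : Gvertex n k b) : nat := set_min (val X).
Definition vmax (n k b : nat) (X : Gvertex n k b) : nat := set_max (val X).

Lemma card_vertex (n k b : nat) (X : Gvertex n k b) : #|val X| = k.
Proof. by case/andP: (valP X) => /eqP. Qed.

Lemma vmax_leq (n k b : nat) (X : Gvertex n k b) : vmax X <= vmin X + b.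
Proof. by case/andP: (valP X) => _; rewrite leq_subLR. Qed.

Lemma vertex_itv (n k b : nat) (X : Gvertex n k b) (x : 'I_n.+1) :
  x \in val X -> vmin X <= x <= vmax X.
Proof. by move=> xX; rewrite set_min_leq ?set_max_geq. Qed.

Lemma vmin_in (n k b : nat) (X : Gvertex n k b) : 0 < k ->
  exists2 x, x \in val X & vmin X = x.
Proof. by move=> k0; apply: set_min_in; rewrite card_vertex. Qed.

Lemma vmax_in (n k b : nat) (X : Gvertex n k b) : 0 < k ->
  exists2 x, x \in val X & vmax X = x.
Proof. by move=> k0; apply: set_max_in; rewrite card_vertex. Qed.

Lemma vmax_ub (n k b : nat) (X : Gvertex n k b) : vmax X <= n.
Proof. by apply/bigmax_leqP => x _; rewrite -ltnS. Qed.

Lemma vertex_sub_itv (n k b : nat) (X : Gvertex n k b) :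
  val X \subset [set x : 'I_n.+1 | vmin X <= x < (vmax X).+1].
Proof. by apply/fintype.subsetP => x /vertex_itv; rewrite inE. Qed.

Lemma vmin_vmax (n k b : nat) (X : Gvertex n k b) : 0 < k ->
  vmin X + k <= (vmax X).+1.
Proof.
move=> k0; have := subset_leq_card (vertex_sub_itv X).
rewrite card_vertex card_ord_itv ?ltnS ?vmax_ub //; lia.
Qed.

(** Adjacency of distinct vertices depends on their extremities only. *)
Lemma GadjE (n k b : nat) (X Y : Gvertex n k b) : 0 < k ->
  Gadj X Y = [&& X != Y, vmax X <= vmin Y + b & vmax Y <= vmin X + b].
Proof.
move=> k0; rewrite /Gadj; congr (_ && _).
have hi : set_max (val X :|: val Y) = maxn (vmax X) (vmax Y).
  apply/eqP; rewrite eqn_leq; apply/andP; split.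
    apply/bigmax_leqP => x; rewrite inE => /orP[] /vertex_itv; lia.
  have [x xX ->] := vmax_in X k0; have [y yY ->] := vmax_in Y k0.
  by rewrite geq_max !set_max_geq // inE ?xX ?yY ?orbT.
have lo : set_min (val X :|: val Y) = minn (vmin X) (vmin Y).
  have [x xX xE] := vmin_in X k0; have [y yY yE] := vmin_in Y k0.
  apply/eqP; rewrite eqn_leq; apply/andP; split.
    by rewrite leq_min xE yE !set_min_leq // inE ?xX ?yY ?orbT.
  apply/set_minP; first by rewrite xE geq_min -ltnS ltn_ord.
  by move=> z; rewrite inE => /orP[] /vertex_itv; lia.
rewrite hi lo; have := vmax_leq X; have := vmax_leq Y; lia.
Qed.

(* reflection *)
(** * Reflection and counting *)

Definition rev_set (n r : nat) (X : {set 'I_n.+1}) : {set 'I_n.+1} :=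
  [set inord (r - x) | x : 'I_n.+1 in X].

(** The reflection x -> r - x is injective on the sets with greatest element
    at most r; it exchanges extremities and keeps the diameter, hence turns an
    implication between conditions on the extremities into an inequality
    between numbers of vertices. *)
Lemma card_reflect (n k b r : nat) (P Q : nat -> nat -> bool) :
  0 < k -> r <= n ->
  (forall i j, i <= j <= n -> P i j -> j <= r /\ Q (r - j) (r - i)) ->
  #|[set X : Gvertex n k b | P (vmin X) (vmax X)]|
    <= #|[set X : Gvertex n k b | Q (vmin X) (vmax X)]|.
Proof.
move=> k0 rn PQ.
have key (X : Gvertex n k b) : P (vmin X) (vmax X) ->
  [/\ set_min (rev_set r (val X)) = r - vmax X,
      set_max (rev_set r (val X)) = r - vmin X,
      #|rev_set r (val X)| = k &
      rev_set r (rev_set r (val X)) = val X].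
  move=> PX.
  have ij : vmin X <= vmax X <= n.
    by have := vmin_vmax X k0; have := vmax_ub X; lia.
  have [jr _] := PQ _ _ ij PX.
  have inE' x : (inord (r - x) : 'I_n.+1) = r - x :> nat by rewrite inordK //; lia.
  have le_r x : x \in val X -> x <= r by move=> /vertex_itv; lia.
  have [x xX xE] := vmin_in X k0; have [y yX yE] := vmax_in X k0.
  split.
  - rewrite yE -inE'; apply: set_min_eq; first exact: imset_f.
    by move=> _ /imsetP[z /vertex_itv zX ->]; rewrite !inE'; lia.
  - rewrite xE -inE'; apply: set_max_eq; first exact: imset_f.
    by move=> _ /imsetP[z /vertex_itv zX ->]; rewrite !inE'; lia.
  - rewrite card_in_imset ?card_vertex // => u v /le_r ur /le_r vr.
    by move/(congr1 val) => /= ; rewrite !inE' => h; apply: val_inj => /=; lia.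
  - rewrite /rev_set -imset_comp -[RHS]imset_id; apply: eq_in_imset => z /le_r zr /=.
    by apply: val_inj => /=; rewrite inE' inE'; lia.
(* The default value X of insubd is never reached when P holds. *)
pose g (X : Gvertex n k b) : Gvertex n k b := insubd X (rev_set r (val X)).
have gE X : P (vmin X) (vmax X) -> val (g X) = rev_set r (val X).
  move=> PX; have [h1 h2 h3 _] := key X PX.
  by rewrite val_insubd h3 eqxx h1 h2 /=; have := vmax_leq X; case: ifP => //; lia.
rewrite -(@card_in_imset _ _ g).
  apply/subset_leq_card/fintype.subsetP => _ /imsetP[X + ->]; rewrite !inE => PX.
  have [h1 h2 _ _] := key X PX; rewrite /vmin /vmax gE // h1 h2.
  apply: (PQ _ _ _ PX).2; have := vmin_vmax X k0; have := vmax_ub X; lia.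
move=> X Y; rewrite !inE => PX PY /(congr1 val); rewrite !gE // => h.
by apply: val_inj; have [_ _ _ <-] := key X PX; have [_ _ _ <-] := key Y PY; rewrite h.
Qed.

Lemma card_vertex_set (n k b : nat) (P : pred {set 'I_n.+1}) :
  #|[set X : Gvertex n k b | P (val X)]| =
  #|[set X : {set 'I_n.+1} |
      [&& #|X| == k, set_max X - set_min X <= b & P X]]|.
Proof.
rewrite -(card_imset _ val_inj); apply: eq_card => X; rewrite inE.
apply/imsetP/idP => [[Y]|/and3P[h1 h2 PX]].
  by rewrite inE => PY ->; case/andP: (valP Y) => -> ->; rewrite PY.
have hX : (#|X| == k) && (set_max X - set_min X <= b) by rewrite h1 h2.
by exists (exist _ X hX : Gvertex n k b); rewrite ?inE.
Qed.

(** Removing the least element i leaves an arbitrary set of k - 1 elements of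
    the interval from i + 1 to the smaller of i + b and n. *)
Lemma card_vmin (n k b i : nat) : 0 < k -> i <= n ->
  #|[set X : Gvertex n k b | vmin X == i]| = 'C(minn (i + b) n - i, k - 1).
Proof.
move=> k0 in_; have iP : i < n.+1 by [].
pose J := [set x : 'I_n.+1 | i.+1 <= x < (minn (i + b) n).+1].
have cJ : #|J| = minn (i + b) n - i.
  by rewrite card_ord_itv ?subSS // ltnS geq_minr.
rewrite -cJ -cards_draws (card_vertex_set k b (fun X => set_min X == i)).
pose i' := Ordinal iP.
have niJ (A : {set 'I_n.+1}) : A \subset J -> i' \notin A.
  by move=> /fintype.subsetP sA; apply/negP => /sA; rewrite inE ltnn.
rewrite -[RHS](@card_in_imset _ _ (fun A => i' |: A)); last first.
  move=> A A'; rewrite !inE => /andP[/niJ iA _] /andP[/niJ iA' _] eA.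
  by rewrite -(finset.setU1K iA) eA finset.setU1K.
apply: eq_card => X; rewrite inE; apply/and3P/imsetP.
  case=> /eqP cX dX /eqP minX.
  have iX : i' \in X.
    have X0 : 0 < #|X| by rewrite cX.
    have [x xX] := set_min_in X0.
    by rewrite minX => ix; have -> : i' = x by apply: val_inj.
  exists (X :\ i'); last by rewrite finset.setD1K.
  rewrite inE; apply/andP; split; last first.
    by move: (cardsD1 i' X); rewrite iX cX add1n => ->; rewrite subn1.
  apply/fintype.subsetP => x; rewrite !inE => /andP[nxi xX].
  have := set_min_leq xX; have := set_max_geq xX; rewrite minX.
  have := ltn_ord x; rewrite -val_eqE /= in nxi; lia.
case=> A; rewrite inE => /andP[sA /eqP cA] ->.
have iA := niJ _ sA; move/fintype.subsetP: sA => sA.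
have bnd x : x \in i' |: A -> i <= x <= i + b.
  by rewrite !inE => /orP[/eqP ->|/sA]; rewrite ?inE /=; lia.
have mE : set_min (i' |: A) = i.
  by apply: (@set_min_eq n _ i'); [rewrite finset.setU11 | move=> y /bnd/andP[]].
split; rewrite ?mE //; first by rewrite cardsU1 iA cA; lia.
by rewrite leq_subLR; apply/bigmax_leqP => x /bnd/andP[].
Qed.

Lemma card_vmin_le (n k b i : nat) : 0 < k ->
  #|[set X : Gvertex n k b | vmin X == i]| <= 'C(b, k - 1).
Proof.
move=> k0; have [in_|ni] := leqP i n.
  by rewrite card_vmin //; apply: leq_bin2l; lia.
rewrite (_ : [set _ | _] = finset.set0) ?cards0 //; apply/setP => X; rewrite !inE.
by apply/negbTE; have := vmin_vmax X k0; have := vmax_ub X; lia.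
Qed.

Lemma card_vmin_itv (n k b a t : nat) :
  #|[set X : Gvertex n k b | a <= vmin X < a + t]| =
  \sum_(i < t) #|[set X : Gvertex n k b | vmin X == a + i]|.
Proof.
elim: t => [|t IHt].
  rewrite big_ord0 (_ : [set _ | _] = finset.set0) ?cards0 //; apply/setP => X.
  by rewrite !inE; lia.
rewrite big_ord_recr /= -IHt -[LHS](cardsID [set X | vmin X == a + t]) addnC.
by congr (_ + _); apply: eq_card => X; rewrite !inE; lia.
Qed.

Lemma card_within (n k b lo hi : nat) : 0 < k -> hi <= n -> hi <= lo + b ->
  #|[set X : Gvertex n k b | (lo <= vmin X) && (vmax X <= hi)]| =
  'C(hi.+1 - lo, k).
Proof.
move=> k0 hn hb; rewrite -(card_ord_itv lo (hn : hi < n.+1)) -cards_draws.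
rewrite (card_vertex_set k b (fun X => (lo <= set_min X) && (set_max X <= hi))).
apply: eq_card => X; rewrite !inE; apply/and3P/andP.
  case=> -> _ /andP[lX Xh]; split=> //; apply/fintype.subsetP => x xX.
  by rewrite inE (leq_trans lX) ?set_min_leq //= ltnS (leq_trans _ Xh) ?set_max_geq.
case=> /fintype.subsetP sX cX; rewrite cX.
have X0 : 0 < #|X| by rewrite (eqP cX).
have [x xX ->] := set_min_in X0; have [y yX ->] := set_max_in X0.
by have := sX x xX; have := sX y yX; rewrite !inE; split => //; lia.
Qed.

(** Sort by least element: each of 0, .., n - b is the least element of
    'C(b, k - 1) vertices, and the k-subsets of {n - b + 1, .., n} are all
    vertices. *)
Lemma card_Gvertex (n k b : nat) : 0 < k -> b <= n ->
  #|Gvertex n k b| = (n - b).+1 * 'C(b, k - 1) + 'C(b, k).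
Proof.
move=> k0 bn; rewrite -cardsT -(cardsID [set X | 0 <= vmin X < 0 + (n - b).+1]).
congr (_ + _).
  rewrite finset.setTI card_vmin_itv -[RHS]mulnC -[X in _ * X]card_ord mulnC -sum_nat_const.
  by apply: eq_bigr => i _; rewrite card_vmin //; [congr 'C(_, _)|]; have := ltn_ord i; lia.
have -> : 'C(b, k) = 'C(n.+1 - (n - b).+1, k) by congr 'C(_, _); lia.
rewrite -(@card_within n k b) //; last by lia.
by apply: eq_card => X; rewrite !inE; have := vmax_ub X; lia.
Qed.

(** * Bounds by ordering and by connecting paths *)

(** A k-set of diameter less than k is an interval, and no other vertex with
    the same least element has as small a greatest element. *)
Lemma vertex_eq_interval (n k b : nat) (X Y : Gvertex n k b) : 0 < k ->
  vmin X = vmin Y -> vmax Y <= vmax X -> vmax X < vmin X + k -> X = Y.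
Proof.
move=> k0 emin le_max X_short.
pose J := [set x : 'I_n.+1 | vmin X <= x < (vmax X).+1].
have cJ : #|J| <= k by rewrite card_ord_itv ?ltnS ?vmax_ub //; lia.
have eJ (Z : Gvertex n k b) : vmin Z = vmin X -> vmax Z <= vmax X -> val Z = J.
  move=> eZ leZ; apply/eqP; rewrite eqEcard card_vertex cJ andbT.
  by apply/fintype.subsetP => z /vertex_itv; rewrite inE; lia.
by apply: val_inj; rewrite (eJ X) // (eJ Y).
Qed.

Lemma Gadj_sym (n k b : nat) (X Y : Gvertex n k b) : Gadj X Y = Gadj Y X.
Proof. by rewrite /Gadj eq_sym finset.setUC. Qed.

(** The key is the lexicographic order on (least, greatest) element.  Among the
    vertices Z between adjacent X and Y, all but possibly Y have their least
    element among the b + 1 - k values from that of X on, and each value is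
    taken by at most 'C(b, k - 1) vertices. *)
Lemma GB_le (n k b : nat) : 0 < k -> k - 1 <= b ->
  GB n k b <= (b.+1 - k) * 'C(b, k - 1).
Proof.
move=> k0 kb.
apply: (bandwidth_le_key (kappa := fun X => vmin X * n.+1 + vmax X)) => X Y adjXY.
have {adjXY} [leX leY] : vmax X <= vmin Y + b /\ vmax Y <= vmin X + b.
  by move: adjXY; rewrite !GadjE // => /orP[] /and3P[].
have key_lex (Z W : Gvertex n k b) :
    vmin Z * n.+1 + vmax Z <= vmin W * n.+1 + vmax W ->
    vmin Z < vmin W \/ vmin Z = vmin W /\ vmax Z <= vmax W.
  by have := vmax_ub Z; have := vmax_ub W; nia.
move=> _; set s := b.+1 - k.
have card_window :
    #|[set Z : Gvertex n k b | vmin X <= vmin Z < vmin X + s]| <= s * 'C(b, k - 1).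
  rewrite card_vmin_itv -[s in X in _ <= X]card_ord -sum_nat_const.
  by apply: leq_sum => i _; exact: card_vmin_le.
apply: (@leq_trans #|Y |: [set Z : Gvertex n k b | vmin X <= vmin Z < vmin X + s]|).
  apply/subset_leq_card/fintype.subsetP => Z; rewrite !inE.
  case/andP=> /key_lex XZ /key_lex ZY; have := vmin_vmax Y k0.
  have [//|/eqP nZY Ylen] := eqVneq Z Y.
  have [ltZ|leZ] := ltnP (vmin Z) (vmin X + s); first by rewrite /=; lia.
  (* Here vmin Y = vmin X + b + 1 - k, which forces Y to be an interval. *)
  by case: nZY; symmetry; apply: vertex_eq_interval => //; lia.
rewrite cardsU1; apply: leq_trans (_ : 1 + s * 'C(b, k - 1) <= _) => //.
by apply: leq_add card_window; case: (_ \notin _).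
Qed.

(** A function g that varies by at most B along edges varies by at most
    B * d between vertices that d edges connect.  If Y lies far to the right
    of X, one edge leads from X to the interval of the last k integers up to
    vmin X + b, which is b + 1 - k further to the right. *)
Lemma dist_le_steps (n k b B : nat) (g : Gvertex n k b -> nat) : 0 < k ->
  (forall X Y, Gadj X Y -> g Y <= g X + B) ->
  forall d X Y, vmax Y <= vmin X + d.+1 * (b.+1 - k) + (k - 1) -> k <= b.+1 ->
    vmax X <= vmin Y + b ->
    g Y <= g X + B * d.+1 /\ g X <= g Y + B * d.+1.
Proof.
move=> k0 gB; elim=> [|d IHd] X Y leY kb leX.
  have [->|nXY] := eqVneq X Y; first by rewrite leq_addr.
  have XY : Gadj X Y by rewrite GadjE // nXY; lia.
  by rewrite muln1; split; apply: gB => //; rewrite Gadj_sym.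
have [YX|XY] := leqP (vmax Y) (vmin X + b).
  have [->|nXY] := eqVneq X Y; first by rewrite leq_addr.
  have BB : B <= B * d.+2 by rewrite leq_pmulr.
  have XY : Gadj X Y by rewrite GadjE // nXY; lia.
  have := gB _ _ XY; rewrite Gadj_sym in XY; have := gB _ _ XY.
  by move: (B * _) BB => C; lia.
have Yn := vmax_ub Y; have Yb := vmax_leq Y.
have loP : vmin X + (b.+1 - k) < n.+1 by lia.
have hiP : vmin X + b < n.+1 by lia.
pose J := [set x : 'I_n.+1 | vmin X + (b.+1 - k) <= x < (vmin X + b).+1].
have minJ : set_min J = vmin X + (b.+1 - k).
  apply: (@set_min_eq n J (Ordinal loP)); first by rewrite inE /=; lia.
  by move=> y; rewrite inE => /andP[].
have maxJ : set_max J = vmin X + b.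
  apply: (@set_max_eq n J (Ordinal hiP)); first by rewrite inE /=; lia.
  by move=> y; rewrite inE => /andP[].
have cJ : (#|J| == k) && (set_max J - set_min J <= b).
  by rewrite minJ maxJ card_ord_itv //; lia.
pose Z : Gvertex n k b := exist _ J cJ.
have minZ : vmin Z = vmin X + (b.+1 - k) by [].
have maxZ : vmax Z = vmin X + b by [].
have [ZY YZ] : g Y <= g Z + B * d.+1 /\ g Z <= g Y + B * d.+1.
  by apply: IHd => //; rewrite ?minZ ?maxZ //; lia.
have [eZX|nZX] := eqVneq X Z.
  by rewrite eZX mulnS; lia.
have XZ : Gadj X Z by rewrite GadjE // nZX minZ maxZ; have := vmax_leq X; lia.
have ZX : Gadj Z X by rewrite Gadj_sym.
by have := gB _ _ XZ; have := gB _ _ ZX; rewrite (mulnS B d.+1); lia.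
Qed.

(** Any two vertices are at distance at most n %/ (b + 1 - k) + 1; apply this to
    those with the first and the last label. *)
Lemma GB_diameter (n k b : nat) : 0 < k -> k <= b ->
  #|Gvertex n k b| <= (GB n k b * (n %/ (b.+1 - k)).+1).+1.
Proof.
move=> k0 kb; set V := Gvertex n k b; set s := b.+1 - k; rewrite /GB.
have [->//|] := posnP #|V|; move=> V0.
have [f fP <-] := (bandwidth_min (@Gadj n k b)).1.
set B := numbering_bandwidth _ _.
have Vlt : #|V|.-1 < #|V| by rewrite prednK.
case: (fP) => g fg gf.
pose X := g (Ordinal V0); pose Y := g (Ordinal Vlt).
have fB Z W : Gadj Z W -> f W <= f Z + B.
  by move=> ZW; apply: numbering_adj_le; rewrite ZW.
have far (Z W : V) : vmax W <= vmin Z + (n %/ s).+1 * s + (k - 1).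
  have s0 : 0 < s by rewrite /s; lia.
  have := vmax_ub W; have := divn_eq n s; have := ltn_pmod n s0; rewrite mulSn.
  by lia.
have : f Y <= f X + B * (n %/ s).+1.
  have kb' : k <= b.+1 by lia.
  have [XY|YX] := leqP (vmax X) (vmin Y + b).
    by have [] := dist_le_steps k0 fB (far X Y) kb' XY.
  have Xb := vmax_leq X; have Yb := vmax_leq Y.
  have YX' : vmax Y <= vmin X + b by lia.
  by have [] := dist_le_steps k0 fB (far Y X) kb' YX'.
by rewrite /X /Y !gf /= add0n; move: #|_| => N; lia.
Qed.

(** * The bandwidth for large b *)

Lemma exists_subset_card (T : finType) (A : {set T}) (m : nat) : m <= #|A| ->
  exists2 B : {set T}, B \subset A & #|B| = m.
Proof.
rewrite -bin_gt0 -cards_draws => /card_gt0P[B]; rewrite inE => /andP[sBA /eqP cB].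
by exists B.
Qed.

Lemma card_setU_disj (T : finType) (A B : {set T}) :
  (forall x, x \in A -> x \notin B) -> #|A :|: B| = #|A| + #|B|.
Proof.
move=> AB; rewrite cardsU (_ : A :&: B = finset.set0) ?cards0 ?subn0 //.
by apply/setP => x; rewrite !inE; apply/negP => /andP[/AB/negP].
Qed.

(** U is the set of universal vertices.  Apart from the ties T, the other
    vertices are exchanged by the reflection x -> n - x, so that L and R,
    sharing T as equally as possible, have almost the same size.  The
    reflection x -> b + t - x then proves the balance condition: as t < n - b,
    it maps sets with i + j >= n to sets with i + j < n, hence it never
    produces a tie, and the choice of T1 in T is immaterial. *)
Lemma GB_dense_le (n k b : nat) (m := n - b)
    (U := [set X : Gvertex n k b | (m <= vmin X) && (vmax X <= b)]) :
  0 < k -> b <= n -> 0 < #|U| ->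
  GB n k b <= uphalf (#|Gvertex n k b| + #|U| - 2).
Proof.
move=> k0 bn U0.
pose L' := [set X : Gvertex n k b | (vmin X + vmax X < n) && (vmin X < m)].
pose R' := [set X : Gvertex n k b | (n < vmin X + vmax X) && (b < vmax X)].
pose T := [set X : Gvertex n k b | (vmin X + vmax X == n) && (vmin X < m)].
have half_le : uphalf #|T| <= #|T| by rewrite leq_uphalf_double -addnn leq_addr.
have [T1 /fintype.subsetP sT1 cT1] := exists_subset_card half_le.
pose L := L' :|: T1; pose R := ~: (U :|: L).
have cL : #|L| = #|L'| + uphalf #|T|.
  by rewrite card_setU_disj ?cT1 // => X; rewrite !inE => ?; apply/negP => /sT1; rewrite inE; lia.
have cLR : #|R'| = #|L'|.
  apply/eqP; rewrite eqn_leq; apply/andP; split.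
    apply: (@card_reflect n k b n (fun i j => (n < i + j) && (b < j))
              (fun i j => (i + j < n) && (i < m))) => // i j.
    by rewrite /m; lia.
  apply: (@card_reflect n k b n (fun i j => (i + j < n) && (i < m))
            (fun i j => (n < i + j) && (b < j))) => // i j.
  by rewrite /m; lia.
(* U, L', T and R' are pairwise disjoint. *)
have cV : #|U| + (#|L'| + (#|T| + #|R'|)) <= #|Gvertex n k b|.
  rewrite -card_setU_disj => [|X]; last by rewrite !inE; lia.
  rewrite -card_setU_disj => [|X]; last by rewrite !inE; lia.
  rewrite -card_setU_disj => [|X]; last by rewrite !inE; lia.
  exact: max_card.
have sR X : X \in R -> (X \in R') || (X \in T :\: T1).
  rewrite !inE !negb_or => /and3P[nU nL' ->] /=.
  have := vmax_ub X; have := vmax_leq X; have := vmin_vmax X k0; lia.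
have cR : #|R| <= #|L|.
  apply: (@leq_trans #|R' :|: (T :\: T1)|).
    by apply/subset_leq_card/fintype.subsetP => X /sR; rewrite !inE.
  rewrite (leq_trans (leq_card_setU _ _)) // cLR cL leq_add2l cardsD.
  have -> : T :&: T1 = T1 by apply/finset.setIidPr/fintype.subsetP.
  by rewrite cT1 leq_subLR addnn -leq_uphalf_double.
have cM : #|U| + #|L| <= (uphalf (#|Gvertex n k b| + #|U| - 2)).+1.
  rewrite cLR in cV; rewrite cL.
  by move: U0 cV; move: #|U| #|L'| #|T| #|Gvertex n k b| => D l t N; lia.
apply: (bandwidth_le_split (L := L) (U := U) (R := R)
          (l := @vmin n k b) (r := @vmax n k b)) => // [X|X Y XL YR adjXY].
  by rewrite finset.in_setC finset.in_setU; case: (X \in U); case: (X \in L).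
have {adjXY} leY : vmax Y <= vmin X + b.
  by move: adjXY; rewrite !GadjE // => /orP[] /and3P[].
have tm : vmin X < m.
  by move: XL; rewrite !inE => /orP[/andP[]//|/sT1]; rewrite inE => /andP[].
set t := vmin X in leY tm *.
apply: (@leq_trans #|[set Z : Gvertex n k b |
    (n <= vmin Z + vmax Z) && (b < vmax Z <= b + t)]|).
  apply/subset_leq_card/fintype.subsetP => Z; rewrite [in X in X -> _]inE inE.
  by move=> /andP[/sR]; rewrite !inE; have := vmax_leq Z; lia.
apply: (@leq_trans #|[set Z : Gvertex n k b |
    (vmin Z + vmax Z < n) && (vmin Z < t)]|).
  apply: (@card_reflect n k b (b + t)
    (fun i j => (n <= i + j) && (b < j <= b + t))
    (fun i j => (i + j < n) && (i < t))) => //.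
    by move: tm; rewrite /m; lia.
  by move=> i j; move: tm; rewrite /m; lia.
apply/subset_leq_card/fintype.subsetP => Z; rewrite !inE => /andP[-> lt].
by rewrite lt (ltn_trans lt tm).
Qed.

Lemma GB_dense (n k b : nat) : 0 < k -> n + k <= (2 * b).+1 -> b <= n ->
  GB n k b = uphalf (#|Gvertex n k b| + 'C(2 * b - n + 1, k) - 2).
Proof.
move=> k0 nkb bn; set m := n - b.
pose U := [set X : Gvertex n k b | (m <= vmin X) && (vmax X <= b)].
have cU : #|U| = 'C(2 * b - n + 1, k).
  rewrite card_within //; last by rewrite /m; lia.
  by congr 'C(_, _); rewrite /m; lia.
have U0 : 0 < #|U| by rewrite cU bin_gt0; lia.
rewrite -cU; apply/eqP; rewrite eqn_leq; apply/andP; split.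
  exact: GB_dense_le.
rewrite leq_uphalf_double; apply: bandwidth_ge_universal => // X Y.
rewrite inE => /andP[mX Xb] nYX; rewrite GadjE // eq_sym nYX /=.
apply/orP; left; have := vmin_vmax Y k0; have := vmax_ub Y; have := vmax_leq Y.
by rewrite /m in mX; lia.
Qed.

(** * The bandwidth for small b *)

Lemma mul_bin_pred (k b : nat) : 0 < k -> k * 'C(b, k) = (b.+1 - k) * 'C(b, k - 1).
Proof.
by case: k => // k _; rewrite subn1 subSS; exact: mul_bin_left.
Qed.

(** With s = b + 1 - k, the diameter bound multiplied by s reads
    (n - b) * (k * 'C(b, k)) <= GB n k b * (n + b), and GB n k b * b is at most
    k * 'C(b, k) * b. *)
Lemma GB_defect (n k b : nat) : 0 < k -> k - 1 <= b -> b <= n ->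
  GB n k b <= k * 'C(b, k) /\
  (k * 'C(b, k) - GB n k b) * n <= 2 * b * (k * 'C(b, k)).
Proof.
move=> k0 kb bn; rewrite mul_bin_pred //; have ub := GB_le n k0 kb.
split=> //; set s := b.+1 - k in ub *; set c := 'C(b, k - 1) in ub *.
(* For b = k - 1 there is no edge and both sides vanish. *)
have [s0|s0] := posnP s; first by rewrite s0.
have kb' : k <= b by rewrite /s in s0; lia.
have c0 : 0 < c by rewrite bin_gt0.
have diam := GB_diameter n k0 kb'; rewrite -/s card_Gvertex // -/c in diam.
have steps : (n %/ s).+1 * s <= n + b.
  by have := leq_trunc_div n s; rewrite mulSn /s; lia.
have : (n - b) * (s * c) <= GB n k b * (n + b).
  apply: leq_trans (_ : GB n k b * ((n %/ s).+1 * s) <= _); last by rewrite leq_mul2l steps orbT.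
  rewrite (mulnC s) !mulnA leq_mul2r; apply/orP; right; lia.
move: ub; move: (GB _ _ _) (s * c) => G C ub h.
rewrite mulnBl leq_subLR; rewrite mulnBl in h.
have : G * b <= C * b by rewrite leq_mul2r ub orbT.
by nia.
Qed.

Lemma mul_bin_le_expn (k b : nat) : k * 'C(b, k) <= b ^ k.
Proof.
apply: (@leq_trans (b ^_ k)); first by rewrite -bin_ffact [X in _ <= X]mulnC leq_mul2r fact_geq orbT.
elim: k => // k IHk; rewrite ffactnSr expnSr; apply: leq_mul => //; exact: leq_subr.
Qed.

(** A nonzero defect would be at least 1, hence n <= 2 * b * (k * 'C(b, k)). *)
Lemma GB_small (n k b : nat) : 0 < k -> k - 1 <= b -> b <= n ->
  2 * b ^ k.+1 < n -> GB n k b = k * 'C(b, k).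
Proof.
move=> k0 kb bn small; have [ub def] := GB_defect k0 kb bn.
apply/eqP; rewrite eqn_leq ub /= -subn_eq0 -leqn0 leqNgt; apply/negP => pos.
have := mul_bin_le_expn k b => le_exp.
have : n <= 2 * b * (k * 'C(b, k)) by apply: leq_trans def; rewrite leq_pmull.
rewrite leqNgt => /negP; apply; apply: leq_ltn_trans small.
by rewrite expnS -mulnA !leq_mul.
Qed.

(** * Passage to the reals *)

Local Open Scope classical_set_scope.
Local Open Scope ring_scope.

Lemma ceil_half (R : realType) (m : nat) :
  Num.ceil (m%:R / 2 : R) = (uphalf m)%:Z.
Proof.
apply/eqP; rewrite ceil_eq intrB -!pmulrn.
have : (uphalf m)%:R * 2 = (odd m)%:R + m%:R :> R.
  by rewrite -natrM muln2 uphalfK natrD.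
by case: (odd m) => /=; lra.
Qed.

(** The first two terms of the formula for large b are the number of
    vertices, by k 'C(b + 1, k) = (b + 1) 'C(b, k - 1) and the rule of
    Pascal. *)
Lemma card_Gvertex_natr (R : realType) (n k b : nat) : (0 < k)%N -> (b <= n)%N ->
  n.+1%:R * 'C(b, k - 1)%:R - (k%:R - 1) * 'C(b.+1, k)%:R
    = #|Gvertex n k b|%:R :> R.
Proof.
case: k => // k k0 bn; rewrite card_Gvertex // subn1 /=.
have e : (k.+1 * 'C(b.+1, k.+1) = b.+1 * 'C(b, k))%N by rewrite mul_bin_diag.
have [d ->] : exists d, n = (d + b)%N by exists (n - b)%N; lia.
rewrite addnK natrD natrM.
have {e} : k.+1%:R * 'C(b.+1, k.+1)%:R = b.+1%:R * 'C(b, k)%:R :> R by rewrite -!natrM e.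
rewrite binS natrD -[(d + b).+1]addn1 -[d.+1]addn1 -[b.+1]addn1 -[k.+1]addn1 !natrD.
by nra.
Qed.
Theorem theorem1 (R : realType) (k : nat) (hk : (1 <= k - 1)%N) :
  (forall n b : nat, (k - 1 <= b)%N -> (b <= n)%N ->
     (n%:R + k%:R - 1) / 2 <= b%:R :> R ->
     (GB n k b)%:Z =
       Num.ceil ((n.+1%:R * 'C(b, k - 1)%:R - (k%:R - 1) * 'C(b.+1, k)%:R
                  + 'C(2 * b - n + 1, k)%:R - 2) / 2 : R)) /\
  (forall b : nat -> nat,
     (forall n : nat, (k - 1 <= n)%N -> (k - 1 <= b n)%N /\ (b n <= n)%N) ->
     ((fun n : nat => (b n)%:R : R^o) =o_\oo
          (fun n : nat => n%:R `^ (k.+1%:R^-1) : R^o) ->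
        \forall n \near \oo, GB n k (b n) = (k * 'C(b n, k))%N) /\
     ((fun n : nat => (b n)%:R : R^o) =o_\oo (fun n : nat => n%:R : R^o) ->
        (fun n : nat => (GB n k (b n))%:R : R^o) ~_\oo
          (fun n : nat => (k * 'C(b n, k))%:R : R^o))).
Proof.
have k0 : (0 < k)%N by lia.
split=> [n b kb bn dense|b bP].
  have nkb : (n + k <= (2 * b).+1)%N.
    by rewrite -(ler_nat R) -(addn1 (2 * b)) !natrD; lra.
  have D0 : (0 < 'C(2 * b - n + 1, k))%N by rewrite bin_gt0; lia.
  have N0 : (0 < #|Gvertex n k b|)%N.
    by rewrite card_Gvertex // addn_gt0 muln_gt0 bin_gt0 kb.
  rewrite GB_dense // card_Gvertex_natr // -(ceil_half R); congr (Num.ceil (_ / _)).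
  by rewrite natrB ?natrD //; lia.
split=> [/eqoP small|/eqoP small].
  near=> n.
  have n0 : (0 < n)%N by near: n; exact: nbhs_infty_gt.
  have [|kb bn] := bP n; first by near: n; exact: nbhs_infty_ge.
  apply: GB_small => //.
  (* With 1 / 2 as epsilon, (2 b) ^ (k + 1) <= n, and 2 < 2 ^ (k + 1). *)
  have h : `|(b n)%:R : R^o| <= 2^-1 * `|n%:R `^ k.+1%:R^-1 : R^o|.
    by near: n; apply: small; lra.
  have {}h : 2 * (b n)%:R <= n%:R `^ k.+1%:R^-1 :> R.
    by move: h; rewrite !ger0_norm ?powR_ge0 ?ler0n //; lra.
  have {}h : ((2 * b n) ^ k.+1 <= n)%N.
    have rootK : (n%:R `^ k.+1%:R^-1) ^+ k.+1 = n%:R :> R.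
      by rewrite -powR_mulrn ?powR_ge0 // -powRrM mulVf ?pnatr_eq0 // powRr1.
    by rewrite -(ler_nat R) natrX -rootK natrM lerXn2r // nnegrE ?powR_ge0 // mulr_ge0.
  apply: leq_trans h; rewrite expnMn.
  by rewrite ltn_pmul2r ?expn_gt0 ?(leq_trans hk kb) // -{1}[2%N]expn1 ltn_exp2l.
apply/eqaddoP => e e0; near=> n.
have n0 : (0 < n)%N by near: n; exact: nbhs_infty_gt.
have [|kb bn] := bP n; first by near: n; exact: nbhs_infty_ge.
have [ub def] := GB_defect k0 kb bn.
have h : `|(b n)%:R : R^o| <= e / 2 * `|n%:R : R^o|.
  by near: n; apply: small; lra.
rewrite !ger0_norm ?ler0n // in h.
change (`|(GB n k (b n))%:R - (k * 'C(b n, k))%:R : R| <= e * `|(k * 'C(b n, k))%:R : R|).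
move: ub def; move: (GB n k (b n)) (k * 'C(b n, k))%N => G C ub def.
rewrite distrC !ger0_norm ?subr_ge0 ?ler_nat //.
have {}def : (C%:R - G%:R) * n%:R <= 2 * (b n)%:R * C%:R :> R.
  by rewrite -natrB // -!natrM ler_nat.
have nR : 0 < n%:R :> R by rewrite ltr0n.
rewrite -(ler_pM2r nR); apply: le_trans def _.
have C0 : 0 <= C%:R :> R by [].
by nra.
Unshelve. all: by end_near.
Qed.
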